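(* Let $p$ and $q$ be prime numbers with $p<q$ and $p \equiv q \equiv 3 \pmod 4$. Then $$l\left(\frac{1+\sqrt{pq}}{2}\right) \equiv 1 + \left(\frac{q}{p}\right) \pmod 4,$$ where $\left(\frac{q}{p}\right)$ is the Legendre symbol.
   Context: For a real quadratic irrational number $\alpha$, $l(\alpha)$ denotes the minimal period length of its (eventually periodic) usual (regular) continued fraction expansion $a_0+\cfrac{1}{a_1+\cfrac{1}{a_2+\cdots}}$ with $a_0\in\mathbb{Z}$ and $a_i$ positive integers for $i\ge 1$. *)

(* Defs.v *)
From HB Require Import structures.
From mathcomp Require Import all_boot all_order all_algebra.
From mathcomp Require Import boolp classical_sets reals.

Set Implicit Arguments.
Unset Strict Implicit.
Unset Printing Implicit Defensive.

Import Order.TTheory GRing.Theory Num.Theory.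
Local Open Scope ring_scope.
Local Open Scope classical_set_scope.

(* For irrational x no fractional part vanishes, so no inverse of 0 occurs
   and x = a_0 + 1/(a_1 + 1/(... + 1/cf_complete_quotient x n)) for all n,
   with a_i = cf_partial_quotient x i positive for i >= 1.  For rational x the
   values after the expansion stops are junk (0^-1 = 0). *)
Fixpoint cf_complete_quotient (R : realType) (x : R) (n : nat) : R :=
  if n is m.+1 then
    let y := cf_complete_quotient x m in (y - (Num.floor y)%:~R)^-1
  else x.

Definition cf_partial_quotient (R : realType) (x : R) (n : nat) : int :=
  Num.floor (cf_complete_quotient x n).

Definition eventual_period (T : Type) (a : nat -> T) : set nat :=
  [set l | (0 < l)%N /\
           exists N : nat, forall k, (N <= k)%N -> a (k + l)%N = a k].

Definition minimal_eventual_period (T : Type) (a : nat -> T) : set nat :=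
  [set l | eventual_period a l /\
           forall m, eventual_period a m -> (l <= m)%N].

(* Takes the value 0 when the expansion of x is not eventually periodic. *)
Definition cf_period_length (R : realType) (x : R) : nat :=
  xget 0%N (minimal_eventual_period (cf_partial_quotient x)).

(* Meant for p an odd prime. *)
Definition legendre (a : int) (p : nat) : int :=
  if (p %| a)%Z then 0
  else if [exists x : 'I_p, (x%:Z ^+ 2 == a %[mod p])%Z] then 1
  else - 1.

(* Main.v *)
(* Let D = pq.  Up to an integer translation, (1 + sqrt D) / 2 is the root of
   the reduced form f_0 with leading coefficient 1 and discriminant D, and its
   expansion walks along the cycle f_0, f_1, ..., f_l = f_0 of reduced forms.
   The conjugation x |-> -1/x' reverses this cycle, exchanging f_i and
   f_(l+1-i).  If l were odd, the form fixed by the reversal would write D as a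
   sum of two squares, which p = 3 mod 4 forbids.  So l = 2m, and the exchange
   of f_m and f_(m+1) forces the leading coefficient r of f_m to divide D;
   since 1 < r < sqrt D, r = p.  As f_m is f_0 up to the sign (-1)^m and a
   change of variables, x^2 - pq y^2 = 4 (-1)^m p is solvable.  Then p divides
   x, and reducing modulo p after division by p gives (q/p) = (-1)^(m+1). *)
Require Import Defs.
From HB Require Import structures.
From mathcomp Require Import all_boot all_order all_algebra all_field.
From mathcomp Require Import boolp classical_sets reals.
From mathcomp Require Import zify ring lra.

Set Implicit Arguments.
Unset Strict Implicit.
Unset Printing Implicit Defensive.

Import Order.TTheory GRing.Theory Num.Theory.
Local Open Scope ring_scope.

(** * Reduced forms, their shifts and their reversal *)

Section ReducedForms.
Variables (R : realType) (D : int).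
Hypothesis D_ge0 : 0 <= D.
Hypothesis sqrtD_irrational : forall m k : int, m ^+ 2 = D * k ^+ 2 -> k = 0.

(* [(r, P, s)] stands for the form [r X^2 - P X Y - s Y^2]. *)
Definition qform := (int * int * int)%type.

Definition form_eval (f : qform) (x y : int) : int :=
  f.1.1 * x ^+ 2 - f.1.2 * x * y - f.2 * y ^+ 2.

Definition form_root (f : qform) : R :=
  (f.1.2%:~R + Num.sqrt (D%:~R)) / (2 * f.1.1%:~R).

(* For discriminant [D], the sign conditions say that the root exceeds 1 and
   that its conjugate lies in (-1, 0). *)
Definition reduced (f : qform) : Prop :=
  [/\ 0 < f.1.1, 0 < f.2, f.1.1 < f.1.2 + f.2, f.2 < f.1.2 + f.1.1
    & f.1.2 ^+ 2 + 4 * f.1.1 * f.2 = D].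

(* If [x] is the root of [f] then [1 / (x - a)] is the root of [shift a f]. *)
Definition shift (a : int) (f : qform) : qform :=
  (f.2 + f.1.2 * a - f.1.1 * a ^+ 2, 2 * f.1.1 * a - f.1.2, f.1.1).

Definition step (f : qform) : qform := shift (Num.floor (form_root f)) f.

(* On roots this is [x |-> -1 / x'], with [x'] the conjugate of [x]. *)
Definition flip (f : qform) : qform := (f.2, f.1.2, f.1.1).

Lemma flipK : involutive flip.
Proof. by case=> [[r P] s]. Qed.

Lemma reduced_flip f : reduced f -> reduced (flip f).
Proof.
case: f => [[r P] s] [/= r0 s0 h1 h2 h]; split => //=.
by rewrite -h; ring.
Qed.

(** If y = 1/(x - a), then -1/y' = a - x', so the same digit [a] leads from -1/y' to -1/x'. *)
Lemma shift_flip a f : shift a (flip (shift a f)) = flip f.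
Proof.
case: f => [[r P] s]; rewrite /shift /flip /=.
by congr (_, _, _); ring.
Qed.

(** The source of the sign (-1)^m in the norm equation: one change of sign per step. *)
Lemma form_eval_shift a f x y :
  form_eval (shift a f) x y = - form_eval f (a * x + y) x.
Proof. by case: f => [[r P] s]; rewrite /form_eval /shift /=; ring. Qed.

(** * Comparing integers with the square root of [D] *)

Lemma sqrtD_ge0 : 0 <= Num.sqrt (D%:~R : R).
Proof. exact: sqrtr_ge0. Qed.

Lemma sqr_sqrtD : Num.sqrt (D%:~R : R) ^+ 2 = D%:~R.
Proof. by rewrite sqr_sqrtr // ler0z. Qed.

Lemma square_neqD (m : int) : m ^+ 2 != D.
Proof.
apply/eqP => h; have := @sqrtD_irrational m 1.
by rewrite expr1n mulr1 => /(_ h).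
Qed.

Lemma norm_lt_sqrtD (m : int) :
  (`|m%:~R| < Num.sqrt (D%:~R : R)) = (m ^+ 2 < D).
Proof.
rewrite -(ltr_int R) rmorphXn /=.
have := sqrtD_ge0; have := sqr_sqrtD; set w := Num.sqrt _ => <- w0.
by rewrite -[in RHS]real_normK ?num_real // ltr_pXn2r ?nnegrE.
Qed.

Lemma lt_sqrtD (m : int) : m ^+ 2 < D -> m%:~R < Num.sqrt (D%:~R : R).
Proof. by rewrite -norm_lt_sqrtD; apply: le_lt_trans; exact: ler_norm. Qed.

Lemma gt_sqrtD (m : int) : 0 <= m ->
  (Num.sqrt (D%:~R : R) < m%:~R) = (D < m ^+ 2).
Proof.
move=> m0; rewrite -(ltr_int R D) rmorphXn /=.
have := sqrtD_ge0; have := sqr_sqrtD; set w := Num.sqrt _ => <- w0.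
by rewrite ltr_pXn2r // nnegrE ler0z.
Qed.

(** * Reduction as an injective map on reduced forms *)

Lemma reduced_mid_gt0 f : reduced f -> 0 < f.1.2.
Proof. by case: f => [[r P] s] [/= *]; lia. Qed.

Lemma ltr_form_root f (c : int) : 0 < f.1.1 ->
  (c%:~R < form_root f) = ((2 * f.1.1 * c - f.1.2)%:~R < Num.sqrt (D%:~R : R)).
Proof.
rewrite -(ltr_int R) => r0; rewrite /form_root ltr_pdivlMr ?mulr_gt0 //.
by rewrite rmorphB !rmorphM /=; apply/idP/idP; lra.
Qed.

Lemma gtr_form_root f (c : int) : 0 < f.1.1 ->
  (form_root f < c%:~R) = (Num.sqrt (D%:~R : R) < (2 * f.1.1 * c - f.1.2)%:~R).
Proof.
rewrite -(ltr_int R) => r0; rewrite /form_root ltr_pdivrMr ?mulr_gt0 //.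
by rewrite rmorphB !rmorphM /=; apply/idP/idP; lra.
Qed.

Lemma form_root_gt1 f : reduced f -> 1 < form_root f.
Proof.
case: f => [[r P] s] [/= r0 s0 h1 h2 h].
have := @ltr_form_root (r, P, s) 1 r0 => /= ->.
by apply: lt_sqrtD; rewrite -h; nia.
Qed.

(** Let t be the middle coefficient of [shift a f]. Its leading coefficient is positive, so t^2 < D,
    and is below t + r, so D < (t + 2r)^2; these place the root between [a] and [a + 1]. *)
Lemma floor_form_root f a :
  reduced f -> reduced (shift a f) -> Num.floor (form_root f) = a.
Proof.
case: f => [[r P] s] [/= r0 s0 h1 h2 h] [/= k1 _ k2 k3 k4].
apply/floor_def/andP; split.
  apply: ltW; rewrite ltr_form_root //=.
  by apply: lt_sqrtD; rewrite -k4; nia.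
rewrite gtr_form_root //=.
by rewrite gt_sqrtD -?k4; nia.
Qed.

Lemma reduced_step f : reduced f -> reduced (step f).
Proof.
move=> hf; rewrite /step.
have : 0 < Num.floor (form_root f) by rewrite floor_gt0 ltW ?form_root_gt1.
have := floor_itv (form_root f).
move: (Num.floor _) => a /andP[a_le a_lt] a_gt0.
case: f hf a_le a_lt => [[r P] s] [/= r0 s0 h1 h2 h].
rewrite leNgt !gtr_form_root //= => a_le a_lt.
have := le_lt_trans sqrtD_ge0 a_lt; rewrite ltr0z => /ltW b_ge0.
rewrite gt_sqrtD // in a_lt.
have t_lt : (2 * r * a - P) ^+ 2 < D.
  rewrite lt_neqAle square_neqD /=; have [t0|t0] := leP 0 (2 * r * a - P).
    by move: a_le; rewrite gt_sqrtD // -leNgt.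
  by rewrite -h; nia.
split => //=; last by rewrite -h; ring.
- by rewrite -h in t_lt; nia.
- by rewrite -h in a_lt; nia.
(* [a - 1] also lies between the two roots, which puts the new conjugate above -1. *)
- have u_lt : (2 * r * (a - 1) - P) ^+ 2 < D.
    have [t0|t0] := leP 0 (2 * r * (a - 1) - P); first by nia.
    by rewrite -h; nia.
  by rewrite -h in u_lt; nia.
Qed.

Lemma reduced_iter_step n f : reduced f -> reduced (iter n step f).
Proof. by move=> hf; elim: n => //= n; exact: reduced_step. Qed.

(** By [shift_flip], reusing the digit of [f] gives the reduced form [flip f], so it is the right
    digit. Thus [flip] conjugates [step] to its inverse. *)
Lemma step_flip f : reduced f -> step (flip (step f)) = flip f.
Proof.
move=> hf; have shiftE := shift_flip (Num.floor (form_root f)) f.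
have e : Num.floor (form_root (flip (step f))) = Num.floor (form_root f).
  apply: floor_form_root; first exact/reduced_flip/reduced_step.
  by rewrite shiftE; exact: reduced_flip.
have stepE g : step g = shift (Num.floor (form_root g)) g by [].
by rewrite stepE e.
Qed.

Lemma step_inj f g : reduced f -> reduced g -> step f = step g -> f = g.
Proof.
move=> hf hg e; apply: (inv_inj flipK).
by rewrite -(step_flip hf) -(step_flip hg) e.
Qed.

Lemma iter_step_inj n f g :
  reduced f -> reduced g -> iter n step f = iter n step g -> f = g.
Proof.
move=> hf hg; elim: n => //= n IHn e; apply: IHn.
by apply: step_inj e; exact: reduced_iter_step.
Qed.

(** * Roots of forms and pure periodicity of cycles *)

Lemma form_root_step f : reduced f ->
  form_root (step f) = (form_root f - (Num.floor (form_root f))%:~R)^-1.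
Proof.
move=> hf; apply/esym/mulr1_eq; have := reduced_step hf; rewrite /step.
move: (Num.floor _) => a; case: f hf => [[r P] s] [/= r0 _ _ _ h].
case=> /=; rewrite /form_root /=; move: sqr_sqrtD.
set r' := _ + _ - _; set t := _ - P; set w := Num.sqrt _ => w2 r'0 _ _ _ disc.
have rn0 : r%:~R != 0 :> R by rewrite intr_eq0 gt_eqF.
have r'n0 : r'%:~R != 0 :> R by rewrite intr_eq0 gt_eqF.
have -> : (P%:~R + w) / (2 * r%:~R) - a%:~R = (w - t%:~R) / (2 * r%:~R).
  by rewrite /t rmorphB !rmorphM /=; field.
rewrite mulf_div [X in X / _](_ : _ = 2 * r%:~R * (2 * r'%:~R)); last first.
  have -> : (w - t%:~R) * (t%:~R + w) = w ^+ 2 - t%:~R ^+ 2 by ring.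
  by rewrite w2 -disc rmorphD rmorphXn !rmorphM /=; ring.
by rewrite divff // !mulf_neq0 ?pnatr_eq0.
Qed.

Lemma form_root_inj f g :
  reduced f -> reduced g -> form_root f = form_root g -> f = g.
Proof.
case: f g => [[r P] s] [[r' P'] s'] [/= r0 _ _ _ h] [/= r'0 _ _ _ h'].
rewrite /form_root /=; move: sqr_sqrtD; set w := Num.sqrt _ => w2 e.
have {}e : (P%:~R + w) * r'%:~R = (P'%:~R + w) * r%:~R.
  move: e => /eqP.
  rewrite eqr_div ?mulf_neq0 ?intr_eq0 ?pnatr_eq0 ?lt0r_neq0 // => /eqP e.
  apply: (@mulfI _ 2); first by rewrite pnatr_eq0.
  by rewrite mulrC -mulrA -[in LHS](mulrC 2) e; ring.
(* Comparing irrational parts: w (r - r') is an integer, so r = r'. *)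
have /subr0_eq er : r - r' = 0.
  apply: (@sqrtD_irrational (P * r' - P' * r)); apply: (@intr_inj R).
  rewrite rmorphXn rmorphM rmorphXn rmorphB rmorphB !rmorphM /= -w2.
  have -> : P%:~R * r'%:~R - P'%:~R * r%:~R = w * (r%:~R - r'%:~R).
    by move: e; rewrite !mulrDl; lra.
  by ring.
have eP : P = P'.
  apply/(@mulIf _ r'); first by rewrite gt_eqF.
  apply: (@intr_inj R); rewrite !rmorphM /=.
  by rewrite er !mulrDl in e; move/addIr: e.
congr (_, _, _) => //; nia.
Qed.

Lemma reduced_bound f : reduced f ->
  [/\ `|f.1.1| < `|D|, `|f.1.2| < `|D| & `|f.2| < `|D|]%N.
Proof.
case: f => [[r P] s] [/= r0 s0 h1 h2 <-].
split; nia.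
Qed.

(** There are finitely many reduced forms, so two iterates coincide; injectivity of [step] carries
    the coincidence back to [f]. *)
Lemma step_periodic f : reduced f -> exists2 l, (0 < l)%N & iter l step f = f.
Proof.
move=> hf; pose N := `|D|%N.
(* Absolute values lose nothing, since the coefficients of a reduced form are positive. *)
pose code n := let g := iter n step f in
  (inord `|g.1.1|, inord `|g.1.2|, inord `|g.2|) : 'I_N.+1 * 'I_N.+1 * 'I_N.+1.
pose M := #|{: 'I_N.+1 * 'I_N.+1 * 'I_N.+1}|.
have /injectivePn[i [j ij e]] : ~~ injectiveb (fun i : 'I_M.+1 => code i).
  by apply/negP => /injectiveP /leq_card; rewrite card_ord ltnn.
have {}e : iter i step f = iter j step f.
  move: e; rewrite /code.
  have := reduced_iter_step i hf; have := reduced_iter_step j hf.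
  move: (iter i _ _) (iter j _ _) => g k hk hg.
  have [gN1 gN2 gN3] := reduced_bound hg.
  have [kN1 kN2 kN3] := reduced_bound hk.
  have gP := reduced_mid_gt0 hg; have kP := reduced_mid_gt0 hk.
  case: g k hk hg gN1 gN2 gN3 kN1 kN2 kN3 gP kP => [[r P] s] [[r' P'] s'].
  move=> [/= ? ? _ _ _] [/= ? ? _ _ _] ? ? ? ? ? ? ? ? e.
  case: e => /(congr1 val) /= e1 /(congr1 val) /= e2 /(congr1 val) /= e3.
  rewrite !inordK in e1 e2 e3; try lia.
  by congr (_, _, _); lia.
wlog lt_ij : i j ij e / (i < j)%N.
  move=> H; have := ij; rewrite neq_ltn => /orP[] h; first exact: H h.
  by apply: H (esym e) h; rewrite eq_sym.
exists (j - i)%N; first by rewrite subn_gt0.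
apply/esym/(@iter_step_inj i) => //; first exact: reduced_iter_step.
by rewrite -iterD subnKC // ltnW.
Qed.

(** * From cycles of forms to periods of continued fractions *)

Lemma cf_complete_quotient_form f n : reduced f ->
  cf_complete_quotient (form_root f) n = form_root (iter n step f).
Proof.
move=> hf; elim: n => //= n ->.
by rewrite form_root_step //; exact: reduced_iter_step.
Qed.

(* Since [x - y = 1 / x' - 1 / y'] when [x] and [y] have the same integral
   part, the distance between roots with equal digits strictly increases along
   the expansion, which periodicity forbids unless it vanishes. *)
Lemma reduced_digits_inj f g : reduced f -> reduced g ->
  (forall k, Num.floor (form_root (iter k step f)) =
             Num.floor (form_root (iter k step g))) -> f = g.
Proof.
move=> hf hg fg; apply: form_root_inj => //; apply/eqP/negPn/negP => neq.
pose d k := `|form_root (iter k step f) - form_root (iter k step g)|.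
have dS k : exists2 c, 1 < c & d k.+1 = d k * c.
  have := reduced_iter_step k hf; have := reduced_iter_step k hg.
  rewrite /d /=; move: (fg k); move: (iter k step f) (iter k step g).
  move=> u v uv hv hu.
  have := form_root_gt1 (reduced_step hu).
  have := form_root_gt1 (reduced_step hv).
  have := form_root_step hu; have := form_root_step hv; rewrite -uv.
  move: (form_root (step u)) (form_root (step v)) => x y.
  move: (form_root u) (form_root v) (_%:~R) => p q a ey ex y1 x1.
  exists (x * y); first by rewrite mulr_egt1.
  have -> : p - q = x^-1 - y^-1 by rewrite ex ey !invrK; ring.
  rewrite -[x * y]gtr0_norm ?mulr_gt0 ?(lt_trans ltr01) // -normrM distrC.
  congr `|_|; field; rewrite !gt_eqF // (lt_trans ltr01) //.
have d0 : 0 < d 0 by rewrite normr_gt0 subr_eq0.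
have d_gt k : d 0 < d k.+1.
  elim: k => [|k IHk].
    by have [c c1 ->] := dS 0; rewrite ltr_pMr.
  have [c c1 ->] := dS k.+1; apply: (lt_trans IHk).
  by rewrite ltr_pMr // (lt_trans d0).
have [l l0 fl] := step_periodic hf; have [m m0 gm] := step_periodic hg.
have iterM (h : qform) i j : iter i step h = h -> iter (j * i) step h = h.
  by move=> ih; elim: j => // j IHj; rewrite mulSn iterD IHj ih.
have := d_gt (l * m).-1; rewrite prednK ?muln_gt0 ?l0 //.
by rewrite /d (iterM g) // mulnC (iterM f) // ltxx.
Qed.

(** Equal fractional parts give equal digits from index 1 on. Equal tails of digits give equal
    iterates of [f], and injectivity of [step] makes the period pure. *)
Lemma eventual_period_form f x l : reduced f ->
    x - (Num.floor x)%:~R = form_root f - (Num.floor (form_root f))%:~R ->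
  eventual_period (cf_partial_quotient x) l <->
  (0 < l)%N /\ iter l step f = f.
Proof.
move=> hf xf; have digit n : (0 < n)%N ->
    cf_partial_quotient x n = Num.floor (form_root (iter n step f)).
  case: n => // n _; rewrite /cf_partial_quotient -cf_complete_quotient_form //.
  by congr Num.floor; elim: n => /= [|n ->] //; rewrite xf.
split=> [[l0 [N per]]|[l0 fl]]; split => //; last first.
  by exists 1%N => k k0; rewrite !digit ?addn_gt0 ?k0 // iterD fl.
apply: (@iter_step_inj N.+1); rewrite -?iterD //.
  exact: reduced_iter_step.
apply: reduced_digits_inj => [||k]; try exact: reduced_iter_step.
rewrite -!iterD -!digit ?addnS // (_ : (k + (N + l)).+1 = (k + N).+1 + l)%N.
  by rewrite per //; lia.
by lia.
Qed.

Lemma cf_period_length_form f x (l := cf_period_length x) : reduced f ->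
    x - (Num.floor x)%:~R = form_root f - (Num.floor (form_root f))%:~R ->
  [/\ (0 < l)%N, iter l step f = f &
      forall m, (0 < m)%N -> iter m step f = f -> (l <= m)%N].
Proof.
move=> hf xf; have per := eventual_period_form _ hf xf.
have [|min1 min2] :=
  @xgetPex _ 0%N (minimal_eventual_period (cf_partial_quotient x)).
  (* A least period exists, so [xget] does not return its default. *)
  have exP : exists m, (0 < m)%N && (iter m step f == f).
    by have [m m0 /eqP fm] := step_periodic hf; exists m; rewrite m0.
  have [m /andP[m0 /eqP fm] mmin] := ex_minnP exP.
  exists m; split; first exact/per.
  by move=> k /per[k0 /eqP fk]; apply: mmin; rewrite k0.
have [l0 fl] := (per _).1 min1.
by split => // m m0 fm; apply: min2; apply/per.
Qed.

(** * Symmetry of the principal cycle and its middle form *)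

Lemma flip_iter_step f l i j : reduced f -> flip f = step f ->
  iter l step f = f -> (i + j = l.+1)%N -> flip (iter i step f) = iter j step f.
Proof.
(* For i = 0 the claim is f_(l+1) = f_1; then [step_flip] and injectivity move one step from j to
   i. *)
move=> hf f1 fl; elim: i j => [|i IHi] j.
  by rewrite add0n => -> /=; rewrite fl.
rewrite addSnnS => /IHi /= e; apply: step_inj.
- exact/reduced_flip/reduced_step/reduced_iter_step.
- exact: reduced_iter_step.
by rewrite -e step_flip //; exact: reduced_iter_step.
Qed.

Lemma form_eval_iter n f x y : exists u v,
  form_eval (iter n step f) x y = (-1) ^+ n * form_eval f u v.
Proof.
elim: n x y => [|n IHn] x y; first by exists x, y; rewrite mul1r.
rewrite iterS form_eval_shift.
have [u [v ->]] := IHn (Num.floor (form_root (iter n step f)) * x + y) x.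
by exists u, v; rewrite exprS mulN1r mulNr.
Qed.

(** Reducedness confines the middle coefficient to an interval of length 2, and the discriminant
    fixes its parity. *)
Lemma principal_form_uniq f g :
  reduced f -> reduced g -> f.1.1 = 1 -> g.1.1 = 1 -> f = g.
Proof.
case: f g => [[r P] s] [[r' P'] s'].
move=> [/= _ s0 h1 h2 h] [/= _ s'0 h'1 h'2 h'] r1 r'1; subst r r'.
have [] : P < P' + 2 /\ P' < P + 2 by split; nia.
move=> lt1 lt2.
have [e|[e|e]] : P = P' \/ (P = P' + 1 \/ P' = P + 1) by lia.
- by congr (_, _, _) => //; rewrite e in h; lia.
- by rewrite e in h; lia.
- by rewrite e in h'; lia.
Qed.

Lemma principal_form (e : int) (x := (1 + Num.sqrt (D%:~R : R)) / 2) :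
    D = 4 * e + 1 ->
  exists f, [/\ reduced f, f.1.1 = 1, flip f = step f
    & x - (Num.floor x)%:~R = form_root f - (Num.floor (form_root f))%:~R].
Proof.
move=> De; have D1 : 1 <= D by lia.
have : 1 <= Num.sqrt (D%:~R : R).
  by rewrite -[leLHS]sqrtr1 ler_wsqrtr // (ler_int R 1).
have /andP[] := floor_itv x; set b := Num.floor x.
rewrite /x; move: gt_sqrtD; set w := Num.sqrt _ => gtw b_le b_lt w1.
have b1 : 1 <= b by rewrite /b floor_ge_int /x -/w; lra.
have lo : (2 * b - 1) ^+ 2 < D.
  rewrite lt_neqAle square_neqD leNgt -gtw; last by lia.
  by rewrite -leNgt rmorphB rmorphM /=; lra.
have hi : D < (2 * b + 1) ^+ 2.
  rewrite -gtw; last by lia.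
  by move: b_lt; rewrite !rmorphD rmorphM /=; lra.
(* The root of [f] is x + b - 1, the translate of x whose conjugate lies in (-1, 0). *)
pose f : qform := (1, 2 * b - 1, e - b ^+ 2 + b).
have hf : reduced f.
  by split => //=; rewrite ?De in lo hi *; [nia|nia|nia|ring].
have shiftE : shift (2 * b - 1) f = flip f.
  by rewrite /shift /flip /=; congr (_, _, _); ring.
have floorE : Num.floor (form_root f) = 2 * b - 1.
  by apply: floor_form_root => //; rewrite shiftE; exact: reduced_flip.
have stepE : step f = shift (Num.floor (form_root f)) f by [].
exists f; split => //; first by rewrite stepE floorE shiftE.
rewrite floorE /form_root /f /= -/w rmorphB rmorphM /=.
by field.
Qed.

(** The reversal fixes the index (l + 1)/2; a form with r = s has discriminant P^2 + (2r)^2. *)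
Lemma odd_period_sum_squares f l : reduced f -> flip f = step f ->
  iter l step f = f -> odd l -> exists x y : int, D = x ^+ 2 + y ^+ 2.
Proof.
move=> hf f1 fl odd_l.
have l2 : (uphalf l + uphalf l = l.+1)%N.
  by rewrite addnn -[RHS]odd_double_half /= odd_l.
have := flip_iter_step hf f1 fl l2; have := reduced_iter_step (uphalf l) hf.
case: (iter _ _ _) => [[r P] s] [/= _ _ _ _ h] [sr].
by exists P, (2 * r); rewrite -h sr; ring.
Qed.

(** The middle form has its flip as successor, so P = 2ra - P; hence P = ra and r divides D = P^2 +
    4rs. If r were 1, this form would be [f]. *)
Lemma even_period_norm f m : reduced f -> f.1.1 = 1 -> flip f = step f ->
    iter m.*2 step f = f -> iter m step f <> f ->
  exists r, [/\ 1 < r, r ^+ 2 < D, (r %| D)%Z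
    & exists x y, x ^+ 2 - D * y ^+ 2 = 4 * (-1) ^+ m * r].
Proof.
move=> hf f11 f1 fl fm.
have m2 : (m + m.+1 = m.*2.+1)%N by rewrite addnS addnn.
have [u [v]] := form_eval_iter m f 1 0.
have := flip_iter_step hf f1 fl m2; have := reduced_iter_step m hf.
move: fm; rewrite iterS.
have stepE : step (iter m step f) =
  shift (Num.floor (form_root (iter m step f))) (iter m step f) by [].
rewrite stepE; move: (Num.floor _); move: (iter m step f) => g a gf hg gg guv.
have : g.1.1 != 1 by apply/eqP => g1; apply: gf; exact: principal_form_uniq.
case: g hg gg guv {gf stepE} => [[r P] s] [/= r0 s0 h1 h2 h].
rewrite /shift /flip /form_eval /= => -[_ Pra] ruv r1.
exists r; split; first by lia.
(* The first product is P^2 - (r - s)^2, whence D > (r + s)^2. *)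
- have : 0 < (P + s - r) * (P + r - s) by apply: mulr_gt0; lia.
  have : 0 < r * s by exact: mulr_gt0.
  have : 0 < s * s by exact: mulr_gt0.
  by rewrite -h; lia.
- have Pe : P = r * a by lia.
  by rewrite -h Pe; apply/dvdzP; exists (r * a ^+ 2 + 4 * s); ring.
case: f hf f11 ruv {f1 fl} => [[r' P0] t] [/= _ _ _ _ h0] r'1 ruv; subst r'.
(* Completing the square in 4 f(u, v). *)
exists (2 * u - P0 * v), v.
have -> : r = (-1) ^+ m * (u ^+ 2 - P0 * u * v - t * v ^+ 2) by lia.
have sg : (-1) ^+ m * (-1) ^+ m = 1 :> int by rewrite -expr2 sqrr_sign.
have -> k : 4 * (-1) ^+ m * ((-1) ^+ m * k) =
    (-1) ^+ m * (-1) ^+ m * (4 * k) :> int.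
  by ring.
by rewrite sg -h0; ring.
Qed.

End ReducedForms.

(** * Squares modulo [p] and divisors of [pq] *)

Lemma intr_Fp_eq0 p (x : int) : prime p -> (x%:~R == 0 :> 'F_p) = (p %| x)%Z.
Proof. by move=> hp; rewrite (dvdz_pcharf (pchar_Fp hp)). Qed.

Lemma legendre_Fp (a : int) p : prime p -> ~~ (p %| a)%Z ->
  legendre a p = if [exists t : 'F_p, t ^+ 2 == a%:~R] then 1 else - 1.
Proof.
move=> hp pa; rewrite /legendre (negPf pa); congr (if _ then _ else _).
have sqE (x : int) : (x ^+ 2 == a %[mod p])%Z = (x%:~R ^+ 2 == a%:~R :> 'F_p).
  by rewrite eqz_mod_dvd -intr_Fp_eq0 // rmorphB rmorphXn subr_eq0.
apply/existsP/existsP => [[x]|[t /eqP ta]].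
  by rewrite sqE => xa; exists x%:Z%:~R.
have t_lt : (t < p)%N by rewrite -[X in (_ < X)%N](Fp_cast hp).
exists (Ordinal t_lt); rewrite sqE -ta /=.
by rewrite -[(Posz t)%:~R]/(t%:R) natr_Zp.
Qed.

Lemma Fp_sqr_neqN1 p (t : 'F_p) : prime p -> p = 3 %[mod 4] -> t ^+ 2 != - 1.
Proof.
move=> hp hp4; apply/eqP => t2.
have tp : t ^+ p = t by rewrite -[RHS]expf_card card_Fp.
have t0 : t != 0.
  apply/eqP => t0; move/eqP: t2.
  by rewrite t0 expr0n /= eq_sym oppr_eq0 oner_eq0.
(* p - 1 is twice an odd number, so t^2 = -1 would give t^(p-1) = -1, against Fermat. *)
have pE : p = ((p %/ 4).*2.+1.*2).+1 by have := divn_eq p 4; lia.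
have : t ^+ ((p %/ 4).*2.+1.*2) = 1.
  by apply: (mulfI t0); rewrite -exprS -pE tp mulr1.
rewrite -mul2n exprM t2 -signr_odd /= odd_double expr1 => /eqP.
rewrite -subr_eq0 -opprD oppr_eq0 -(natrD _ 1 1).
by rewrite -[_%:R]/((2%:Z)%:~R) intr_Fp_eq0 // dvdzE /= => /dvdn_leq; lia.
Qed.

Lemma dvdz_sum_squares p (x y : int) : prime p -> p = 3 %[mod 4] ->
  (p %| x ^+ 2 + y ^+ 2)%Z -> (p %| y)%Z.
Proof.
move=> hp hp4; rewrite -!intr_Fp_eq0 // rmorphD !rmorphXn addrC /= => /eqP e.
apply: contraT => y0; have := Fp_sqr_neqN1 (x%:~R / y%:~R) hp hp4.
by rewrite expr_div_n -(addr0_eq e) mulNr divff ?eqxx // expf_neq0.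
Qed.

Lemma sqrt_pq_irrational p q (m k : int) : prime p -> prime q -> (p < q)%N ->
  m ^+ 2 = (p * q)%:Z * k ^+ 2 -> k = 0.
Proof.
move=> hp hq hpq e; apply/eqP/negPn/negP => k0.
have {}e : (`|m| ^ 2 = p * q * `|k| ^ 2)%N by rewrite -!abszX e abszM.
have p0 := prime_gt0 hp; have q0 := prime_gt0 hq.
(* The valuation at [p] is even on the left and odd on the right. *)
have := congr1 (odd \o logn p) e.
rewrite /= lognX (lognM p (_ : 0 < p * q)%N)
  ?muln_gt0 ?p0 ?expn_gt0 ?absz_gt0 ?k0 //.
rewrite (lognM p p0 q0) lognX (logn_prime p hp) (logn_prime p hq).
rewrite eqxx (ltn_eqF hpq) !oddD.
by case: (odd (logn p `|m|)); case: (odd (logn p `|k|)).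
Qed.

(** Since r^2 < pq < q^2, [q] cannot divide [r], so [r] divides [p]. *)
Lemma dvd_pq_lt_sqrt p q r : prime p -> prime q -> (p < q)%N ->
  (1 < r)%N -> (r ^ 2 < p * q)%N -> (r %| p * q)%N -> r = p.
Proof.
move=> hp hq hpq r1 rlt rd.
have p1 := prime_gt1 hp.
have qr : ~~ (q %| r)%N.
  by apply/negP => /dvdn_leq; nia.
have : (r %| p)%N.
  by move: rd; rewrite Gauss_dvdl // coprime_sym prime_coprime.
by case/primeP: hp => _ /[apply] /orP[] /eqP ?; lia.
Qed.

(** * The period modulo 4 *)

Theorem corollary3p13 (R : realType) (p q : nat) (hp : prime p) (hq : prime q)
    (hpq : (p < q)%N) (hp4 : p = 3 %[mod 4]) (hq4 : q = 3 %[mod 4]) :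
  ((cf_period_length ((1 + Num.sqrt ((p * q)%:R : R)) / 2))%:Z
     = 1 + legendre q%:Z p %[mod 4])%Z.
Proof.
rewrite -[(p * q)%:R]/((p * q)%:Z%:~R : R).
have D0 : 0 <= (p * q)%:Z by [].
have irr m k := @sqrt_pq_irrational p q m k hp hq hpq.
have De : (p * q)%:Z = 4 * ((p * q) %/ 4)%N%:Z + 1.
  have : (p * q = 1 %[mod 4])%N by rewrite -modnMm hp4 hq4.
  by have := divn_eq (p * q) 4; lia.
have [f [hf f11 f1 xf]] := @principal_form R _ D0 irr _ De.
have := cf_period_length_form D0 irr hf xf.
set l := cf_period_length _ => -[l0 fl lmin].
have pq : ~~ (p %| q)%N by rewrite dvdn_prime2 // neq_ltn hpq.
have p2 : (2%:Z)%:~R != 0 :> 'F_p.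
  by rewrite intr_Fp_eq0 // dvdzE /=; apply/negP => /dvdn_leq; lia.
have [odd_l|even_l] := boolP (odd l).
  (* An odd period makes [p] divide both x and y, hence p^2 divide pq. *)
  have [x [y xy]] := odd_period_sum_squares D0 irr hf f1 fl odd_l.
  have yp : (p %| y)%Z.
    by apply: (@dvdz_sum_squares p x) => //; rewrite -xy dvdzE /= dvdn_mulr.
  have xp : (p %| x)%Z.
    apply: (@dvdz_sum_squares p y) => //.
    by rewrite addrC -xy dvdzE /= dvdn_mulr.
  case/dvdzP: xp xy => x' -> {x}; case/dvdzP: yp => y' -> {y} xy.
  case/negP: pq; rewrite -(@dvdn_pmul2l p) ?prime_gt0 //.
  have : (p%:Z * p %| (p * q)%:Z)%Z.
    by rewrite xy; apply/dvdzP; exists (x' ^+ 2 + y' ^+ 2); ring.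
  by rewrite -PoszM.
have [m lm] : exists m, l = m.*2.
  by exists l./2; rewrite -[LHS]odd_double_half (negPf even_l).
have fm : iter m (step R (p * q)%:Z) f <> f.
  by move=> /(lmin m); lia.
rewrite lm in fl.
have [r [r1 rlt rd [x [v xv]]]] := even_period_norm D0 irr hf f11 f1 fl fm.
case: r r1 rlt rd xv => // r r1 rlt rd.
rewrite (dvd_pq_lt_sqrt hp hq hpq r1 rlt rd) PoszM {r r1 rlt rd} => xv.
have p0 : p%:Z != 0 by rewrite -lt0n prime_gt0.
have [x' xE] : exists x', x = x' * p%:Z.
  apply/dvdzP; rewrite -intr_Fp_eq0 //.
  have : x ^+ 2 = p%:Z * (q%:Z * v ^+ 2 + 4 * (-1) ^+ m).
    by rewrite mulrDr mulrA; lia.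
  move/(congr1 (fun z : int => z%:~R : 'F_p)); rewrite rmorphXn rmorphM /=.
  rewrite -[p%:~R]/(p%:R : 'F_p) pchar_Fp_0 // mul0r => /eqP.
  by rewrite expf_eq0.
have {}xv : q%:Z * v ^+ 2 = p%:Z * x' ^+ 2 - 4 * (-1) ^+ m.
  by apply: (mulfI p0); move: xv; rewrite xE; lia.
have {xv x' xE} qv : q%:~R * v%:~R ^+ 2 = - (2%:~R ^+ 2 * (-1) ^+ m) :> 'F_p.
  move/(congr1 (fun z : int => z%:~R : 'F_p)): xv.
  rewrite rmorphB !rmorphM !rmorphXn /=.
  rewrite -[p%:~R]/(p%:R : 'F_p) pchar_Fp_0 // mul0r sub0r.
  by rewrite rmorphN1 -(rmorphXn _ 2 2).
have v0 : v%:~R != 0 :> 'F_p.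
  apply/eqP => v0; move/eqP: qv; rewrite v0 expr0n mulr0 eq_sym oppr_eq0.
  by rewrite mulf_eq0 signr_eq0 orbF expf_eq0 (negPf p2).
rewrite legendre_Fp ?dvdzE // lm.
rewrite -[(-1) ^+ m]signr_odd in qv.
(* For odd m, q v^2 = 4, so q is the square of 2/v and l = 2m is 2 modulo 4. *)
have [odd_m|even_m] := boolP (odd m).
  rewrite ifT; first by lia.
  apply/existsP; exists (2%:~R / v%:~R); rewrite expr_div_n.
  move: qv; rewrite odd_m expr1 mulrN1 opprK => <-.
  by rewrite mulfK // expf_neq0.
(* For even m, q v^2 = -4, so q = t^2 would give (t v / 2)^2 = -1. *)
rewrite ifF; first by lia.
apply/negbTE/existsPn => t; apply/eqP => tq.
have := Fp_sqr_neqN1 (t * v%:~R / 2%:~R) hp hp4.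
rewrite expr_div_n exprMn tq qv (negPf even_m) expr0 mulr1 mulNr divff ?eqxx //.
exact: expf_neq0.
Qed.
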